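(* For each $n$, consider the weighted nearest neighbor random walk on the $n$-dimensional hypercube with positive weights $w_i^+,w_i^-$, $1\le i\le n$ (possibly depending on $n$), $\sum_{i=1}^n(w_i^++w_i^-)=1$. Assume that $w_i^+=w_i^-$ for all $i$ and let $w_i=w_i^++w_i^-$. Let $t_*$ be the unique solution to $\sum_{i=1}^ne^{-w_it_*}=\frac12$. If $t_*\min_i\{w_i\}\to\infty$ as $n\to\infty$ and $t_*\min_i\{w_i^2\}$ is bounded over all $n$, then the walk exhibits cutoff (with respect to the separation distance).
   Context: The weighted nearest neighbor random walk on the hypercube $\{+,-\}^n$: at each step, independently, the pair $(i,\epsilon)$ with $1\le i\le n$, $\epsilon\in\{+,-\}$, is chosen with probability $w_i^\epsilon$, and the $i$-th coordinate of the current state is set to $\epsilon$ (other coordinates unchanged). (This is the hyperplane walk on the chambers of the Boolean arrangement $\{x_i=0\}$.) Let $\pi$ be its stationary distribution, $P^t$ its $t$-step transition probabilities, and $s(t)=\max_{x_0}\left(1-\min_{x}\frac{P^t(x_0,x)}{\pi(x)}\right)$ the separation distance for integers $t\ge0$; for real $t\ge 0$, $s(t):=s(\lfloor t\rfloor)$. A sequence of walks (indexed by $n$) exhibits cutoff with respect to the separation distance if there exist times $t_n$ and windows $v_n=o(t_n)$ such that $$\lim_{c\to\infty}\liminf_{n\to\infty}s(t_n-cv_n)=1,\qquad\lim_{c\to\infty}\limsup_{n\to\infty}s(t_n+cv_n)=0.$$ *)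

(* Defs.v *)
From HB Require Import structures.
From mathcomp Require Import all_boot all_order all_algebra.
From mathcomp Require Import all_classical all_reals all_analysis.

Set Implicit Arguments.
Unset Strict Implicit.
Unset Printing Implicit Defensive.

Import Order.TTheory GRing.Theory Num.Theory.
Import numFieldNormedType.Exports.

Local Open Scope classical_set_scope.
Local Open Scope ring_scope.

(* [x0] only witnesses that [T] is nonempty: the value does not depend on it. *)
Definition fin_max (R : realType) (T : finType) (x0 : T) (F : T -> R) : R :=
  \big[Num.max/F x0]_(x : T) F x.

Definition fin_min (R : realType) (T : finType) (x0 : T) (F : T -> R) : R :=
  \big[Num.min/F x0]_(x : T) F x.

(* [true] stands for the sign + and [false] for the sign -. *)
Definition cube (n : nat) : finType := {ffun 'I_n -> bool}.

Definition all_plus (n : nat) : cube n := [ffun=> true].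

Definition set_coord (n : nat) (x : cube n) (i : 'I_n) (e : bool) : cube n :=
  [ffun j => if j == i then e else x j].

Definition trans (R : realType) (n : nat) (w : 'I_n -> bool -> R)
    (x y : cube n) : R :=
  \sum_(i < n) \sum_(e : bool) w i e * (set_coord x i e == y)%:R.

Fixpoint transn (R : realType) (n : nat) (w : 'I_n -> bool -> R) (t : nat)
    (x y : cube n) : R :=
  if t is t'.+1 then \sum_(z : cube n) transn w t' x z * trans w z y
  else (x == y)%:R.

Definition stationary (R : realType) (n : nat) (w : 'I_n -> bool -> R)
    (pi : cube n -> R) : Prop :=
  [/\ forall x, 0 <= pi x,
      \sum_(x : cube n) pi x = 1 &
      forall y, \sum_(x : cube n) pi x * trans w x y = pi y].

Definition separation (R : realType) (n : nat) (w : 'I_n -> bool -> R)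
    (pi : cube n -> R) (t : nat) : R :=
  fin_max (all_plus n) (fun x0 =>
    1 - fin_min (all_plus n) (fun x => transn w t x0 x / pi x)).

(* [Num.truncn t] is the floor of [t] for [0 <= t], and [0] for [t < 0]. *)
Definition separationR (R : realType) (n : nat) (w : 'I_n -> bool -> R)
    (pi : cube n -> R) (t : R) : R :=
  separation w pi (Num.truncn t).

(* [s n] is the distance to stationarity of the n-th walk, as a function of
   real time.  Inferior and superior limits are taken in the extended reals,
   where they always exist. *)
Definition cutoff (R : realType) (s : nat -> R -> R) : Prop :=
  exists t v : nat -> R,
    [/\ (forall n, 0 < t n) /\ (forall n, 0 < v n),
        v =o_\oo t,
        limn_einf (fun n => (s n (t n - c * v n))%:E) @[c --> +oo] --> 1%:E &
        limn_esup (fun n => (s n (t n + c * v n))%:E) @[c --> +oo] --> 0%:E].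

(* Main.v *)
Require Import Defs.
From HB Require Import structures.
From mathcomp Require Import all_boot all_order all_algebra.
From mathcomp Require Import all_classical all_reals all_analysis.
From mathcomp Require Import ring lra.

Set Implicit Arguments.
Unset Strict Implicit.
Unset Printing Implicit Defensive.

Import Order.TTheory GRing.Theory Num.Theory.
Import numFieldNormedType.Exports.

Local Open Scope classical_set_scope.
Local Open Scope ring_scope.

(* Call a coordinate collected once it has been selected; it is then uniform and
   independent of the others.  Hence the least likely state relative to [pi] is
   the antipode of the starting point, and the separation distance at time [t]
   is the probability that some coupon is still missing at time [t] in the
   coupon collector problem with weights [w].  We take [t_n = tstar n] and
   [v_n = 1 / min_i w_i].  After [t_n + c v_n] steps the union bound shows that
   a coupon is missing with probability at most [e^(1 - c)].  After
   [t_n - c v_n] steps the expected number of missing coupons is at least of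
   order [e^c], and since the missing events are negatively correlated, the
   second moment method shows that some coupon is missing with probability
   [1 - O(e^(- c))]. *)

Lemma exists_notin (T : finType) (S : {set T}) :
  S != [set: T]%SET -> exists i, i \notin S.
Proof.
move=> ST; apply/existsP; rewrite -negb_forall; apply: contra ST => /forallP ST.
by apply/eqP/setP => i; rewrite inE ST.
Qed.

(** * Coupon collector: first and second moments of the number of missing coupons *)

Section Collector.
Variables (R : realType) (n : nat) (w : 'I_n -> R).
Hypothesis w_ge0 : forall i, 0 <= w i.
Hypothesis w_sum1 : \sum_i w i = 1.

Implicit Types (f g : {set 'I_n} -> R) (S : {set 'I_n}).

Definition collect f S : R := \sum_i w i * f (i |: S).

(* The expectation of [f] applied to the set of coupons held after [t] draws,
   starting with those in [S]. *)
Definition expect (t : nat) f S : R := iter t collect f S.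

Lemma expectS t f : expect t.+1 f = collect (expect t f).
Proof. by []. Qed.

Lemma expectSr t f : expect t.+1 f = expect t (collect f).
Proof. by rewrite /expect -iterSr. Qed.

Lemma eq_expect t f g S : f =1 g -> expect t f S = expect t g S.
Proof. by move=> fg; have -> : f = g by apply: funext. Qed.

Lemma expect_sum (I : finType) t (F : I -> {set 'I_n} -> R) S :
  expect t (fun S => \sum_j F j S) S = \sum_j expect t (F j) S.
Proof.
elim: t S => [//|t IH] S; rewrite expectS /collect.
under eq_bigr do rewrite IH mulr_sumr.
by rewrite exchange_big.
Qed.

Lemma expectZ t a f S : expect t (fun S => a * f S) S = a * expect t f S.
Proof.
elim: t S => [//|t IH] S; rewrite !expectS /collect mulr_sumr.
by apply: eq_bigr => i _; rewrite IH mulrCA.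
Qed.

Lemma expectD t f g S :
  expect t (fun S => f S + g S) S = expect t f S + expect t g S.
Proof.
elim: t S => [//|t IH] S; rewrite !expectS /collect -big_split /=.
by apply: eq_bigr => i _; rewrite IH mulrDr.
Qed.

Lemma expect_cst t a S : expect t (fun=> a) S = a.
Proof.
elim: t S => [//|t IH] S; rewrite expectS /collect.
by under eq_bigr do rewrite IH; rewrite -mulr_suml w_sum1 mul1r.
Qed.

Lemma le_expect t f g S :
  (forall S, f S <= g S) -> expect t f S <= expect t g S.
Proof.
move=> fg; elim: t S => [//|t IH] S; rewrite !expectS /collect.
by apply: ler_sum => i _; rewrite ler_wpM2l.
Qed.

(* [j \notin S] is an eigenfunction of [collect], as is the product of two
   such indicators. *)
Lemma expect_notin t j S :
  expect t (fun S => (j \notin S)%:R) S = (1 - w j) ^+ t * (j \notin S)%:R.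
Proof.
elim: t S => [|t IH] S; first by rewrite mul1r.
rewrite expectS /collect; under eq_bigr do rewrite IH.
rewrite (bigD1 j) //= setU11 /= !mulr0 add0r.
rewrite (eq_bigr (fun i => w i * ((1 - w j) ^+ t * (j \notin S)%:R))); last first.
  by move=> i ij; rewrite !inE eq_sym (negbTE ij).
rewrite -mulr_suml mulrA exprS.
suff -> : \sum_(i < n | i != j) w i = 1 - w j by [].
by apply/eqP; rewrite eq_sym subr_eq addrC -w_sum1 (bigD1 j).
Qed.

Lemma expect_notin2 t j k S : j != k ->
  expect t (fun S => (j \notin S)%:R * (k \notin S)%:R) S =
    (1 - w j - w k) ^+ t * ((j \notin S)%:R * (k \notin S)%:R).
Proof.
move=> jk; elim: t S => [|t IH] S; first by rewrite mul1r.
rewrite expectS /collect; under eq_bigr do rewrite IH.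
rewrite (bigD1 j) //= setU11 /= mul0r !mulr0 add0r.
rewrite (bigD1 k) 1?eq_sym //= setU11 /= !mulr0 add0r.
rewrite (eq_bigr (fun i => w i * ((1 - w j - w k) ^+ t *
   ((j \notin S)%:R * (k \notin S)%:R)))); last first.
  by move=> i /andP[ij ik]; rewrite !inE ![_ == i]eq_sym (negbTE ij) (negbTE ik).
rewrite -mulr_suml exprS !mulrA.
suff -> : \sum_(i < n | (i != j) && (i != k)) w i = 1 - w j - w k by [].
apply/eqP; rewrite eq_sym !subr_eq -w_sum1 (bigD1 j) //= (bigD1 k) 1?eq_sym //=.
by apply/eqP; ring.
Qed.

Definition all_collected (t : nat) : R :=
  expect t (fun S => (S == [set: 'I_n]%SET)%:R) finset.set0.

(** The expected number of coupons missing after [t] draws from the empty set: each draw avoids [i]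
    with probability [1 - w i]. *)
Definition mean_missing (t : nat) : R := \sum_i (1 - w i) ^+ t.

Lemma weight_le1 i : w i <= 1.
Proof. by rewrite -w_sum1 (bigD1 i) //= lerDl sumr_ge0. Qed.

Lemma all_collected_ge0 t : 0 <= all_collected t.
Proof.
rewrite -[leLHS](expect_cst t 0 finset.set0).
by apply: le_expect => S; rewrite ler0n.
Qed.

Lemma all_collected_le1 t : all_collected t <= 1.
Proof.
rewrite -[leRHS](expect_cst t 1 finset.set0).
by apply: le_expect => S; rewrite lern1 leq_b1.
Qed.

Lemma sum_notin_setT : \sum_(i < n) (i \notin [set: 'I_n]%SET)%:R = 0 :> R.
Proof. by rewrite big1 // => i _; rewrite inE. Qed.

(** Markov's inequality: an incomplete collection misses at least one coupon. *)
Lemma union_bound t : 1 - all_collected t <= mean_missing t.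
Proof.
have -> : mean_missing t =
    expect t (fun S => \sum_i (i \notin S)%:R) finset.set0.
  rewrite expect_sum; apply: eq_bigr => i _.
  by rewrite expect_notin inE mulr1.
rewrite lerBlDr -expectD -[leLHS](expect_cst t 1 finset.set0).
apply: le_expect => S /=.
have [_|ST] := eqVneq S [set: 'I_n]%SET.
  by rewrite lerDr; apply: sumr_ge0 => i _; rewrite ler0n.
rewrite addr0; have [i iS] := exists_notin ST.
by rewrite (bigD1 i) //= iS lerDl; apply: sumr_ge0 => j _; rewrite ler0n.
Qed.

(* Second moment method: the events [i \notin S] are pairwise negatively
   correlated, so the variance of the number of missing coupons is at most its
   mean. *)
Lemma second_moment t : 0 < mean_missing t ->
  all_collected t <= (mean_missing t)^-1.
Proof.
set m := mean_missing t => m0.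
pose N (S : {set 'I_n}) : R := \sum_i (i \notin S)%:R.
have EN : expect t N finset.set0 = m.
  by rewrite expect_sum; apply: eq_bigr => i _; rewrite expect_notin inE mulr1.
have EN2 : expect t (fun S => N S * N S) finset.set0 <= m + m * m.
  rewrite (@eq_expect t _
      (fun S => \sum_i \sum_j (i \notin S)%:R * (j \notin S)%:R)); last first.
    move=> S; rewrite /N mulr_suml.
    by apply: eq_bigr => i _; rewrite mulr_sumr.
  rewrite expect_sum {1 2}/m /mean_missing mulr_suml -big_split /=.
  apply: ler_sum => i _; rewrite expect_sum (bigD1 i) //=.
  apply: lerD.
    rewrite (@eq_expect t _ (fun S => (i \notin S)%:R)).
      by rewrite expect_notin inE mulr1.
    by move=> S; rewrite -natrM mulnb andbb.
  rewrite /m /mean_missing mulr_sumr [leRHS](bigD1 i) //= -[leLHS]add0r.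
  apply: lerD; first by rewrite mulr_ge0 // exprn_ge0 // subr_ge0 weight_le1.
  apply: ler_sum => j ji; rewrite expect_notin2 1?eq_sym // !inE !mulr1 -exprMn.
  (* Negative correlation is [1 - w i - w j <= (1 - w i) * (1 - w j)]. Taking powers needs the left
     side nonnegative: it is the sum of the other weights. *)
  apply: lerXn2r; rewrite ?nnegrE.
  - rewrite -w_sum1 (bigD1 i) //= (bigD1 j) //= addrAC addrA.
    rewrite [_ + w j + _]addrAC [w i + _]addrC.
    have -> : \sum_(k < n | (k != i) && (k != j)) w k + w i + w j - w j - w i =
      \sum_(k < n | (k != i) && (k != j)) w k by ring.
    exact: sumr_ge0.
  - by rewrite mulr_ge0 // subr_ge0 weight_le1.
  - have := mulr_ge0 (w_ge0 i) (w_ge0 j); lra.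
(* Chebyshev, pointwise: the indicator of a full collection is at most [(1 - N S / m) ^+ 2], since
   [N S = 0] there. *)
apply: (@le_trans _ _ (expect t (fun S =>
    1 + (- (2 / m) * N S + m^-1 ^+ 2 * (N S * N S))) finset.set0)).
  apply: le_expect => S /=.
  have -> : 1 + (- (2 / m) * N S + m^-1 ^+ 2 * (N S * N S)) =
    (1 - N S / m) ^+ 2 by ring.
  have [->|_] := eqVneq S [set: 'I_n]%SET; last exact: sqr_ge0.
  by rewrite /N sum_notin_setT mul0r subr0 expr1n.
rewrite !expectD expect_cst !expectZ EN.
have : m^-1 ^+ 2 * expect t (fun S => N S * N S) finset.set0 <=
    m^-1 ^+ 2 * (m + m * m).
  by rewrite ler_wpM2l // sqr_ge0.
have -> : m^-1 ^+ 2 * (m + m * m) = m^-1 + 1 by field; rewrite gt_eqF.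
have -> : - (2 / m) * m = -2 by field; rewrite gt_eqF.
lra.
Qed.

End Collector.

(** * Reduction of the walk to the coupon collector *)

Section Walk.
Variables (R : realType) (n : nat) (v : 'I_n -> bool -> R) (w : 'I_n -> R).
Hypothesis v_gt0 : forall i e, 0 < v i e.
Hypothesis v_sym : forall i, v i true = v i false.
Hypothesis wE : forall i, w i = v i true + v i false.
Hypothesis w_sum1 : \sum_i w i = 1.

Implicit Types (S : {set 'I_n}) (x y z : cube n).

Lemma weight_gt0 i : 0 < w i.
Proof. by rewrite wE addr_gt0. Qed.

Lemma weight_ge0 i : 0 <= w i.
Proof. exact: ltW (weight_gt0 i). Qed.

(* The law of the state given that exactly the coordinates in [S] have been
   refreshed. *)
Definition refreshed x y S : R :=
  \prod_i (if i \in S then 2^-1 else (y i == x i)%:R).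

Lemma set_coord_eq z y i e : (set_coord z i e == y) =
  [forall j, (j != i) ==> (z j == y j)] && (e == y i).
Proof.
apply/eqP/andP => [<-|[/forallP zy /eqP ei]].
  split; last by rewrite ffunE eqxx.
  by apply/forallP => j; apply/implyP => ji; rewrite ffunE (negbTE ji).
apply/ffunP => j; rewrite ffunE; case: eqVneq => [->//|ji].
by have /implyP/(_ ji)/eqP := zy j.
Qed.

(** Reverses a move: if [z] and [y] agree off [i], exactly one sign contributes on each side;
    otherwise none does. *)
Lemma sum_set_coord_eq z y i :
  \sum_(e : bool) (set_coord z i e == y)%:R =
  \sum_(b : bool) (z == set_coord y i b)%:R :> R.
Proof.
rewrite !big_bool /= !set_coord_eq ![z == _]eq_sym !set_coord_eq.
have -> : [forall j, (j != i) ==> (y j == z j)] =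
          [forall j, (j != i) ==> (z j == y j)].
  by apply: eq_forallb => j; rewrite [y j == _]eq_sym.
by case: [forall j, _]; case: (y i); case: (z i) => //=; rewrite addrC.
Qed.

(** Only the factor at [i] depends on [b]; its two values sum to [1] whether or not [i \in S], and
    on the right it is [2^-1]. *)
Lemma sum_refreshed_set_coord x y S i :
  \sum_(b : bool) refreshed x (set_coord y i b) S =
  2 * refreshed x y (i |: S).
Proof.
pose r := \prod_(j | j != i) (if j \in S then 2^-1 else (y j == x j)%:R : R).
have E b : refreshed x (set_coord y i b) S =
    (if i \in S then 2^-1 else (b == x i)%:R) * r.
  rewrite /refreshed (bigD1 i) //= ffunE eqxx; congr (_ * _).
  by apply: eq_bigr => j ji; rewrite ffunE (negbTE ji).
have -> : refreshed x y (i |: S) = 2^-1 * r.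
  rewrite /refreshed (bigD1 i) //= setU11; congr (_ * _).
  by apply: eq_bigr => j ji; rewrite !inE (negbTE ji).
rewrite big_bool /= !E -mulrDl mulrA divff ?pnatr_eq0 // mul1r.
case: (i \in S); last by case: (x i); rewrite /= ?addr0 ?add0r mul1r.
by rewrite -[RHS]mul1r; congr (_ * _); lra.
Qed.

(** Intertwines the two chains: by [v_sym] the chosen coordinate gets a fair sign, so a step of the
    walk acts on the law as the draw of one coupon. *)
Lemma refreshed_step x y S :
  \sum_z refreshed x z S * trans v z y = collect w (refreshed x y) S.
Proof.
under eq_bigr do rewrite /trans mulr_sumr.
rewrite exchange_big /=; apply: eq_bigr => i _.
transitivity (\sum_z refreshed x z S *
    (w i / 2 * \sum_(b : bool) (z == set_coord y i b)%:R)).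
  apply: eq_bigr => z _; congr (_ * _); rewrite -sum_set_coord_eq mulr_sumr.
  apply: eq_bigr => e _; congr (_ * _).
  by have := v_sym i; rewrite wE; case: e => ?; lra.
transitivity (w i / 2 * \sum_(b : bool) refreshed x (set_coord y i b) S).
  rewrite mulr_sumr.
  under eq_bigr do rewrite mulrCA mulr_sumr mulr_sumr.
  rewrite exchange_big /=; apply: eq_bigr => b _.
  rewrite (bigD1 (set_coord y i b)) //= eqxx mulr1 big1 ?addr0 // => z zb.
  by rewrite (negbTE zb) !mulr0.
by rewrite sum_refreshed_set_coord mulrA divfK ?pnatr_eq0.
Qed.

Lemma transn_expect t x y :
  transn v t x y = expect w t (refreshed x y) finset.set0.
Proof.
elim: t y => [|t IH] y.
  rewrite /expect /= /refreshed; have [->|xy] := eqVneq x y.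
    by rewrite big1 // => i _; rewrite inE eqxx.
  have [i yi] : exists i, y i != x i.
    apply/existsP; rewrite -negb_forall; apply: contra xy => /forallP H.
    by apply/eqP/ffunP => i; apply/esym/eqP; exact: H.
  by rewrite (bigD1 i) //= inE (negbTE yi) mul0r.
rewrite expectSr [LHS]/=.
have -> : collect w (refreshed x y) =
    fun S => \sum_z trans v z y * refreshed x z S.
  apply: funext => S; rewrite -refreshed_step.
  by apply: eq_bigr => z _; rewrite mulrC.
rewrite expect_sum; apply: eq_bigr => z _.
by rewrite expectZ IH mulrC.
Qed.

Lemma refreshed_setT x y : refreshed x y [set: 'I_n]%SET = 2^-1 ^+ n.
Proof.
rewrite /refreshed; under eq_bigr do rewrite inE.
by rewrite prodr_const card_ord.
Qed.

Lemma refreshed_ge0 x y S : 0 <= refreshed x y S.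
Proof.
by apply: prodr_ge0 => i _; case: ifP => _; rewrite ?ler0n // invr_ge0 ler0n.
Qed.

Lemma refreshed_le1 x y S : refreshed x y S <= 1.
Proof.
apply: numdomain.Num.Theory.prodr_ile1 => i _.
case: ifP => _; last by rewrite ler0n lern1 leq_b1.
by apply/andP; split; lra.
Qed.

(** A coordinate not yet refreshed keeps its starting sign, which rules out the antipode. *)
Lemma refreshed_antipode x S :
  refreshed x [ffun i => ~~ x i] S = 2^-1 ^+ n * (S == [set: 'I_n]%SET)%:R.
Proof.
have [->|ST] := eqVneq S [set: 'I_n]%SET; first by rewrite refreshed_setT mulr1.
have [i iS] := exists_notin ST.
rewrite /refreshed (bigD1 i) //= (negbTE iS) ffunE mulr0.
by case: (x i); rewrite mul0r.
Qed.

Local Notation p := (all_collected w).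

Lemma transn_ge t x y : 2^-1 ^+ n * p t <= transn v t x y.
Proof.
rewrite transn_expect /all_collected -expectZ.
apply: le_expect => [|S]; first exact: weight_ge0.
have [->|_] := eqVneq S [set: 'I_n]%SET; first by rewrite refreshed_setT mulr1.
by rewrite mulr0 refreshed_ge0.
Qed.

(** Bounds the law by [1] on incomplete sets; crude, but sharp in the limit since [p t] tends to
    [1]. *)
Lemma transn_le t x y :
  transn v t x y <= 2^-1 ^+ n * p t + (1 - p t).
Proof.
have -> : 2^-1 ^+ n * p t + (1 - p t) =
    expect w t (fun S => 1 + (2^-1 ^+ n - 1) * (S == [set: 'I_n]%SET)%:R)
      finset.set0.
  by rewrite expectD expect_cst // expectZ -/(p t); ring.
rewrite transn_expect; apply: le_expect => [|S]; first exact: weight_ge0.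
have [->|_] := eqVneq S [set: 'I_n]%SET.
  by rewrite refreshed_setT mulr1 addrC subrK.
by rewrite mulr0 addr0 refreshed_le1.
Qed.

Lemma transn_antipode t x : transn v t x [ffun i => ~~ x i] = 2^-1 ^+ n * p t.
Proof.
rewrite transn_expect /all_collected -expectZ.
by apply: eq_expect => S; rewrite refreshed_antipode.
Qed.

Lemma mean_missing_cvg0 : mean_missing w t @[t --> \oo] --> (0 : R).
Proof.
have -> : (0 : R) = \sum_(i < n) 0 by rewrite big1.
apply: cvg_big => [|i _]; first exact: add_continuous.
apply: cvg_expr.
have w1 := weight_le1 weight_ge0 w_sum1 i; have w0 := weight_gt0 i.
by rewrite ger0_norm; lra.
Qed.

Lemma all_collected_cvg1 : p t @[t --> \oo] --> (1 : R).
Proof.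
apply: (@squeeze_cvgr _ _ _ _ (fun t => 1 - mean_missing w t) (fun=> 1)).
- near=> t; rewrite all_collected_le1 ?andbT //; last exact: weight_ge0.
  have := union_bound weight_ge0 w_sum1 t; lra.
- rewrite -[X in _ --> X]subr0; apply: cvgB; first exact: cvg_cst.
  exact: mean_missing_cvg0.
- exact: cvg_cst.
Unshelve. all: by end_near. Qed.

Lemma stationary_transn pi t y : stationary v pi ->
  \sum_x pi x * transn v t x y = pi y.
Proof.
move=> [_ _ piP]; elim: t y => [|t IH] y /=.
  rewrite (bigD1 y) //= eqxx mulr1 big1 ?addr0 // => x xy.
  by rewrite (negbTE xy) mulr0.
under eq_bigr do rewrite mulr_sumr.
rewrite exchange_big /= -piP; apply: eq_bigr => z _.
by rewrite -IH mulr_suml; apply: eq_bigr => x _; rewrite mulrA.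
Qed.

(** By stationarity [pi y] is, for every [t], an average of [t]-step transition probabilities, and
    these are squeezed to [2^-1 ^+ n]. *)
Lemma stationary_uniform pi : stationary v pi -> forall y, pi y = 2^-1 ^+ n.
Proof.
move=> st y; have [pi0 pi1 _] := st.
have avg a : \sum_x pi x * a = a by rewrite -mulr_suml pi1 mul1r.
have c : (cst (pi y) : nat -> R) @ \oo --> 2^-1 ^+ n * (1 : R).
  apply: (@squeeze_cvgr _ _ _ _ (fun t => 2^-1 ^+ n * p t)
      (fun t => 2^-1 ^+ n * p t + (1 - p t))).
  - near=> t; rewrite -(stationary_transn t y st); apply/andP; split.
      rewrite -[leLHS]avg; apply: ler_sum => x _.
      by rewrite ler_wpM2l // transn_ge.
    rewrite -[leRHS]avg; apply: ler_sum => x _.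
    by rewrite ler_wpM2l // transn_le.
  - apply: cvgM; [exact: cvg_cst|exact: all_collected_cvg1].
  - rewrite -[X in _ --> X]addr0; apply: cvgD.
      apply: cvgM; [exact: cvg_cst|exact: all_collected_cvg1].
    rewrite -(subrr (1 : R)); apply: cvgB; first exact: cvg_cst.
    exact: all_collected_cvg1.
rewrite -[RHS]mulr1.
apply: (cvg_unique _ _ c) => //; exact: cvg_cst.
Unshelve. all: by end_near. Qed.

(** The ratio is at least [p t] by [transn_ge], with equality at the antipode. This holds for every
    start, so the outer maximum is over a constant. *)
Lemma separation_all_collected pi t : stationary v pi ->
  separation v pi t = 1 - p t.
Proof.
move=> st; have piE := stationary_uniform st.
have n0 : 0 < 2^-1 ^+ n :> R by rewrite exprn_gt0.
have minE x : fin_min (all_plus n) (fun y => transn v t x y / pi y) = p t.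
  apply/eqP; rewrite eq_le; apply/andP; split.
    apply: (le_trans (bigmin_le _ [ffun i => ~~ x i] _)).
    by rewrite transn_antipode piE mulrAC divff ?mul1r // gt_eqF.
  by apply: le_bigmin => [|y _]; rewrite piE ler_pdivlMr // mulrC transn_ge.
rewrite /separation /fin_max minE.
under eq_bigr do rewrite minE.
by elim/big_ind: _ => // a b -> ->; rewrite maxxx.
Qed.

End Walk.

(** * Upper and lower limits under eventual bounds *)

Section Limits.
Variable R : realType.
Implicit Types (u : nat -> \bar R) (l : \bar R).

Lemma limn_esup_le_near u l : (\forall n \near \oo, (u n <= l)%E) ->
  (limn_esup u <= l)%E.
Proof.
move=> ul; apply: (@le_trans _ _ (ereal_sup (u @` [set n | (u n <= l)%E]))).
  by apply: ereal_inf_lbound; exists [set n | (u n <= l)%E].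
by apply: ge_ereal_sup => _ [n /= un <-].
Qed.

Lemma limn_einf_ge_near u l : (\forall n \near \oo, (l <= u n)%E) ->
  (l <= limn_einf u)%E.
Proof.
move=> ul; rewrite /limn_einf leeNr; apply: limn_esup_le_near.
by apply: filterS ul => n; rewrite leeN2.
Qed.

End Limits.

(** * Comparison of powers with exponentials *)

Section Exponential.
Variable R : realType.

(** After inversion, [1 + y <= expR y] leaves [1 <= (1 + y) * (1 - x)], whose excess
    [x ^+ 2 * (1 - 2 * x)] is nonnegative for [x <= 2^-1]. *)
Lemma expR_le_1Bx (x : R) : 0 <= x <= 2^-1 ->
  expR (- (x + 2 * x ^+ 2)) <= 1 - x.
Proof.
move=> /andP[x0 x2]; set y := x + _.
have y0 : 0 <= y by rewrite addr_ge0 // mulr_ge0 // sqr_ge0.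
rewrite expRN -[leRHS]invrK lef_pV2 ?posrE ?expR_gt0 ?invr_gt0 //; last by lra.
apply: le_trans (expR_ge1Dx y).
rewrite -[leLHS]mul1r ler_pdivrMr; last by lra.
rewrite /y; have : 0 <= x ^+ 2 * (1 - 2 * x) by rewrite mulr_ge0 ?sqr_ge0 //; lra.
have -> : (1 + (x + 2 * x ^+ 2)) * (1 - x) = 1 + x ^+ 2 * (1 - 2 * x) by ring.
lra.
Qed.

(* The coupons for which the Poissonian approximation [expR (- (w * ts))] of the
   probability of being missing is inaccurate are those with [4 <= w ^+ 2 * ts];
   there [expR (- (w * ts)) <= w / 4], which sums to at most [1 / 4]. *)
Lemma expR_le_missing (w wm ts c : R) k : 0 < wm -> wm <= w -> w <= 1 ->
  0 <= c -> 16 <= ts -> k%:R <= ts - c * wm^-1 ->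
  expR (- (w * ts)) <= w / 4 + expR (8 - c) * (1 - w) ^+ k.
Proof.
move=> wm0 wmw w1 c0 ts16 kt.
have w0 : 0 < w by exact: lt_le_trans wmw.
have [big|small] := leP 4 (w ^+ 2 * ts).
  apply: (@le_trans _ _ (w / 4)).
    rewrite expRN -[leRHS]invrK lef_pV2 ?posrE ?expR_gt0 ?invr_gt0 ?divr_gt0 //.
    apply: le_trans (expR_ge1Dx _); rewrite invf_div ler_pdivrMr //.
    by rewrite mulrDl mul1r mulrAC -expr2; lra.
  by rewrite lerDl mulr_ge0 ?expR_ge0 // exprn_ge0 // subr_ge0.
(* [2^-1 < w] and [16 <= ts] would give [4 < w ^+ 2 * ts]. *)
have w2 : w <= 2^-1.
  rewrite leNgt; apply/negP => w2.
  have : w ^+ 2 * 16 <= w ^+ 2 * ts by rewrite ler_wpM2l // sqr_ge0.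
  nra.
apply: (@le_trans _ _ (expR (8 - c) * expR (- (w + 2 * w ^+ 2)) ^+ k)); last first.
  rewrite -[leLHS]add0r; apply: lerD; first by rewrite divr_ge0 // ltW.
  rewrite ler_wpM2l ?expR_ge0 // lerXn2r ?nnegrE ?expR_ge0 ?subr_ge0 //.
  by rewrite expR_le_1Bx // (ltW w0) w2.
(* The constant [8] absorbs [2 * (w ^+ 2 * ts)], bounded by [small]; the term [- c] comes from
   [wm <= w]. *)
rewrite -expRM_natl -expRD ler_expR.
have q0 : 0 <= c * wm^-1 by rewrite mulr_ge0 // invr_ge0 ltW.
have wc : c <= w * (c * wm^-1).
  by rewrite mulrCA ler_peMr // ler_pdivlMr // mul1r.
have a0 : 0 <= w + 2 * w ^+ 2 by rewrite addr_ge0 ?mulr_ge0 ?sqr_ge0 ?(ltW w0).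
have := ler_wpM2l a0 kt.
have : 0 <= w ^+ 2 * (c * wm^-1) by rewrite mulr_ge0 // sqr_ge0.
have -> : (w + 2 * w ^+ 2) * (ts - c * wm^-1) = w * ts + 2 * (w ^+ 2 * ts)
  - w * (c * wm^-1) - 2 * (w ^+ 2 * (c * wm^-1)) by ring.
move: wc small; rewrite mulrN [_ * k%:R]mulrC; lra.
Qed.

End Exponential.

(** * Bounds after and before the cutoff time *)

Section CutoffBounds.
Variables (R : realType) (n : nat) (w : 'I_n -> R) (wm ts : R).
Hypothesis wm_gt0 : 0 < wm.
Hypothesis wm_le : forall i, wm <= w i.
Hypothesis w_sum1 : \sum_i w i = 1.
Hypothesis tsE : \sum_i expR (- (w i * ts)) = 2^-1.

Let w_gt0 i : 0 < w i := lt_le_trans wm_gt0 (wm_le i).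
Let w_ge0 i : 0 <= w i := ltW (w_gt0 i).

(** Union bound with [1 - w i <= expR (- w i)]. The extra time gains [expR (- c)] since [wm <= w i];
    rounding it down costs at most [expR 1] since [w i <= 1]. *)
Lemma missing_after c : 0 <= c -> 0 <= ts ->
  1 - all_collected w (Num.truncn (ts + c * wm^-1)) <= expR (1 - c).
Proof.
move=> c0 ts0; apply: (le_trans (union_bound _ _ _)) => //.
set k := Num.truncn _.
have q0 : 0 <= c * wm^-1 by rewrite mulr_ge0 // invr_ge0 ltW.
have kt : ts + c * wm^-1 <= k%:R + 1.
  by rewrite natr1 ltW //; case/andP: (truncn_itv (addr_ge0 ts0 q0)).
apply: (@le_trans _ _ (\sum_i expR (1 - c) * expR (- (w i * ts)))); last first.
  by rewrite -mulr_sumr tsE ler_piMr ?expR_ge0 //; lra.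
apply: ler_sum => i _.
apply: (@le_trans _ _ (expR (- w i) ^+ k)).
  rewrite lerXn2r ?nnegrE ?expR_ge0 ?subr_ge0 ?weight_le1 //.
  exact: expR_ge1Dx.
rewrite -expRM_natl -expRD ler_expR.
have w1 := weight_le1 w_ge0 w_sum1 i.
have wc : c <= w i * (c * wm^-1).
  by rewrite mulrCA ler_peMr // ler_pdivlMr // mul1r.
have := ler_wpM2l (w_ge0 i) kt; rewrite !mulrDr mulrN [k%:R * _]mulrC; lra.
Qed.

Lemma collected_before c : 0 <= c -> 16 <= ts -> c * wm^-1 <= ts ->
  all_collected w (Num.truncn (ts - c * wm^-1)) <= 4 * expR (8 - c).
Proof.
move=> c0 ts16 cts; set k := Num.truncn _.
(* [cts] matters: on negative times [Num.truncn] is [0] and this bound would fail. *)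
have kt : k%:R <= ts - c * wm^-1 by rewrite truncn_le subr_ge0.
(* Sum [expR_le_missing] over the coupons: the left sides give [2^-1] by [tsE], the terms [w i / 4]
   give [4^-1]. *)
have m_ge : 4^-1 <= expR (8 - c) * mean_missing w k.
  suff : 2^-1 <= 4^-1 + expR (8 - c) * mean_missing w k by lra.
  have <- : \sum_i w i / 4 = 4^-1 by rewrite -mulr_suml w_sum1 mul1r.
  rewrite -tsE mulr_sumr -big_split /=.
  apply: ler_sum => i _; apply: (@expR_le_missing _ _ wm) => //.
  exact: weight_le1.
have m_gt0 : 0 < mean_missing w k.
  by rewrite -(pmulr_rgt0 _ (expR_gt0 (8 - c))); lra.
apply: (le_trans (second_moment _ _ m_gt0)) => //.
rewrite -[leLHS]mul1r ler_pdivrMr //; lra.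
Qed.

End CutoffBounds.

(* The n-th walk lives on the cube of dimension n.+1, so that dimensions
   range over the positive integers. *)
Theorem proposition12 (R : realType)
    (wpm : forall n : nat, 'I_n.+1 -> bool -> R)
    (wpm_gt0 : forall n (i : 'I_n.+1) (e : bool), 0 < wpm n i e)
    (wpm_sum1 : forall n, \sum_(i < n.+1) (wpm n i true + wpm n i false) = 1)
    (wpm_sym : forall n (i : 'I_n.+1), wpm n i true = wpm n i false)
    (w : forall n : nat, 'I_n.+1 -> R)
    (wE : forall n (i : 'I_n.+1), w n i = wpm n i true + wpm n i false)
    (pi : forall n : nat, cube n.+1 -> R)
    (pi_stat : forall n, stationary (wpm n) (pi n))
    (tstar : nat -> R)
    (tstarE : forall n, \sum_(i < n.+1) expR (- (w n i * tstar n)) = 2^-1)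
    (tmin_pinfty : tstar n * fin_min ord0 (w n) @[n --> \oo] --> +oo)
    (tmin2_bounded : exists M : R, forall n,
      `|tstar n * fin_min ord0 (fun i => w n i ^+ 2)| <= M) :
  cutoff (fun n => separationR (wpm n) (pi n)).
Proof.
pose wm n := fin_min ord0 (w n).
have w_sum1 n : \sum_i w n i = 1.
  by rewrite -[RHS](wpm_sum1 n); apply: eq_bigr => i _; rewrite wE.
have w_gt0 n i : 0 < w n i by rewrite wE addr_gt0.
have wm_gt0 n : 0 < wm n.
  apply: (big_ind (fun z => 0 < z)) => // a b a0 b0.
  by rewrite lt_min a0 b0.
have wm_le n i : wm n <= w n i by exact: bigmin_le.
(* If [tstar n <= 0], the term at [ord0] alone is at least [1]. *)
have ts_gt0 n : 0 < tstar n.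
  rewrite ltNge; apply/negP => ts0.
  suff : 1 <= (2^-1 : R) by lra.
  rewrite -(tstarE n) (bigD1 ord0) //= -[leLHS]addr0; apply: lerD.
    by rewrite -expR0 ler_expR oppr_ge0 mulr_ge0_le0 // ltW.
  by apply: sumr_ge0 => i _; exact: expR_ge0.
have sE n t : separationR (wpm n) (pi n) t =
    1 - all_collected (w n) (Num.truncn t).
  exact: separation_all_collected.
have w_ge0 n i : 0 <= w n i by exact: ltW.
have s_ge0 n t : 0 <= separationR (wpm n) (pi n) t.
  by rewrite sE subr_ge0 all_collected_le1.
have s_le1 n t : separationR (wpm n) (pi n) t <= 1.
  by rewrite sE lerBlDr lerDl all_collected_ge0.
have a_large (A : R) : \forall n \near \oo, A <= tstar n * wm n.
  by move/cvgryPge : tmin_pinfty; exact.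
have wm_le1 n : wm n <= 1 by apply: le_trans (wm_le n ord0) _; exact: weight_le1.
exists tstar, (fun n => (wm n)^-1); split.
- by split=> // n; rewrite invr_gt0.
(* The window condition amounts to [e^-1 <= tstar n * wm n] eventually. *)
- apply/eqoP => e e0; near=> n.
  rewrite !gtr0_norm ?invr_gt0 // -[leLHS]mul1r ler_pdivrMr // -mulrA.
  rewrite -ler_pdivrMl // mulr1.
  by near: n; exact: a_large.
- apply: (@squeeze_cvge _ _ _ _ (fun c => (1 - 4 * (expR 8 * expR (- c)))%:E)
      _ (fun=> 1%:E)).
  + near=> c; have c0 : 0 <= c by near: c; exact: nbhs_pinfty_ge.
    apply/andP; split; last first.
      apply: (le_trans (limn_einf_sup _)); apply: limn_esup_le_near.
      by near=> n; rewrite lee_fin.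
    (* With [c] fixed, the divergence of [tstar n * wm n] gives [c * (wm n)^-1 <= tstar n]
       eventually, and also [16 <= tstar n] because [wm n <= 1]. *)
    apply: limn_einf_ge_near; near=> n; rewrite lee_fin sE -expRD.
    have cw : c <= tstar n * wm n by near: n; exact: a_large.
    have ts16 : 16 <= tstar n.
      apply: (@le_trans _ _ (tstar n * wm n)); first by near: n; exact: a_large.
      by rewrite ler_piMr // ltW.
    rewrite lerD2l lerN2; apply: collected_before => //.
    by rewrite ler_pdivrMr.
  + apply: cvg_EFin; first by near=> c.
    rewrite -[X in _ --> X]subr0; apply: cvgB; first exact: cvg_cst.
    rewrite -(mulr0 4); apply: cvgM; first exact: cvg_cst.
    rewrite -(mulr0 (expR 8)); apply: cvgM; first exact: cvg_cst.
    exact: cvgr_expR.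
  + exact: cvg_cst.
- apply: (@squeeze_cvge _ _ _ _ (fun=> 0%:E) _
      (fun c => (expR 1 * expR (- c))%:E)).
  + near=> c; have c0 : 0 <= c by near: c; exact: nbhs_pinfty_ge.
    apply/andP; split.
      apply: le_trans (limn_einf_sup _); apply: limn_einf_ge_near.
      by near=> n; rewrite lee_fin.
    apply: limn_esup_le_near; near=> n; rewrite lee_fin sE -expRD.
    by apply: missing_after => //; exact: ltW.
  + exact: cvg_cst.
  + apply: cvg_EFin; first by near=> c.
    rewrite -(mulr0 (expR 1)); apply: cvgM; first exact: cvg_cst.
    exact: cvgr_expR.
Unshelve. all: by end_near. Qed.
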